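(* There is a universal constant $c>0$ such that the following holds. Let $1\le m\le n$ be integers, $p\in[0,1]$, and consider the asymmetric model. Given any estimator $\tilde M$ and any $\delta\in[0,m\sqrt n]$, there exist an $m\times n$ parameter matrix $M$ satisfying $\|M\|_*\le\delta$ and a data matrix $X$ with mean $M$ such that, for this $M$ and $X$, the estimator $\tilde M$ satisfies $$\operatorname{MSE}(\tilde M)\ge c\min\left\{\frac{\delta}{m\sqrt{np}},\ \frac{\delta^2}{mn},\ 1\right\}.$$ Moreover, if $p<1/2$, then $X$ and $M$ may be chosen such that $X=M$. The same lower bound holds (with $m=n$) in the symmetric model and in the skew-symmetric model.
   Context: Notation: $\|M\|_*$ is the nuclear norm (sum of singular values). For an estimator $\tilde M=(\tilde m_{ij})$ of an $m\times n$ matrix $M=(m_{ij})$, $\operatorname{MSE}(\tilde M):=\mathbb{E}\big[\frac1{mn}\sum_{i=1}^m\sum_{j=1}^n(\tilde m_{ij}-m_{ij})^2\big]$. When $p=0$ the term $\delta/(m\sqrt{np})$ is read as $+\infty$. Asymmetric model: $1\le m\le n$; the parameter matrix $M$ is a (deterministic) real $m\times n$ matrix with $|m_{ij}|\le1$; a data matrix with mean $M$ is a random $m\times n$ matrix $X$ with independent entries, $\mathbb{E}(x_{ij})=m_{ij}$ and $|x_{ij}|\le1$ almost surely (in particular the non-random choice $X=M$ is allowed); each entry of $X$ is observed with probability $p$ and unobserved with probability $1-p$, independently of everything else. Symmetric model: $m=n$; $M$ and $X$ are symmetric, $|m_{ij}|\le 1$, the entries of $X$ on and above the diagonal are independent with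 $\mathbb{E}(x_{ij})=m_{ij}$ and $|x_{ij}|\le1$ almost surely; each entry on and above the diagonal is observed with probability $p$, independently of everything else, and for $i<j$ the entry $(j,i)$ is observed if and only if $(i,j)$ is. Skew-symmetric model: the same as the symmetric model, except that instead of $M,X$ being symmetric, the difference $X-M$ is skew-symmetric. An estimator $\tilde M$ is a (measurable) matrix-valued function of the observed data, i.e. of the array whose $(i,j)$ entry is $x_{ij}$ if $x_{ij}$ is observed and the symbol ''?'' otherwise.
   Formalization: In the skew-symmetric model the case n=1 with p≥1/2 is excluded: there X−M skew-symmetric forces X=M, so for n=p=δ=1 the estimator returning the observed entry has MSE 0 while the claimed bound is c>0. *)

(* Defs.v *)
From HB Require Import structures.
From mathcomp Require Import all_boot all_order all_algebra.
From mathcomp Require Import spectral complex.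
From mathcomp Require Import all_classical all_reals all_analysis.

Set Implicit Arguments.
Unset Strict Implicit.
Unset Printing Implicit Defensive.

Import Order.TTheory GRing.Theory Num.Theory.
Import numFieldNormedType.Exports.

Local Open Scope classical_set_scope.
Local Open Scope ring_scope.

(* The singular values of M are the square roots of the eigenvalues, with
   multiplicity, of M^T M. The library provides the eigenvalues of a normal
   matrix (spectral_diag) over a closed field only, hence the detour through
   R[i]. For m < n this list is the usual one padded with n - m zeros, which
   does not affect the nuclear norm. *)
Definition singular_value (R : realType) (m n : nat) (M : 'M[R]_(m, n))
    (j : 'I_n) : R :=
  Num.sqrt (complex.Re
    (spectral_diag (map_mx (real_complex R) (M^T *m M)) ord0 j)).

Definition nuclear_norm (R : realType) (m n : nat) (M : 'M[R]_(m, n)) : R :=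
  \sum_(j < n) singular_value M j.

(* [None] stands for the symbol "?". *)
Definition data_array (R : realType) (m n : nat) : Type := 'M[option R]_(m, n).

(* Generators of the product sigma-algebra on data arrays; a set of values of
   an entry is measurable iff its trace on R is, {None} being an atom. *)
Definition data_cylinders (R : realType) (m n : nat) :
    set (set (data_array R m n)) :=
  [set A | exists (i : 'I_m) (j : 'I_n) (B : set (option R)),
     measurable (Some @^-1` B : set R) /\
     A = [set Y : data_array R m n | B (Y i j)]].

Definition is_estimator (R : realType) (m n : nat)
    (f : data_array R m n -> 'M[R]_(m, n)) : Prop :=
  forall (i : 'I_m) (j : 'I_n) (B : set R), measurable B ->
    <<s @data_cylinders R m n >> [set Y | B (f Y i j)].

Definition independent_classes (d : measure_display) (T : measurableType d)
    (R : realType) (P : probability T R) (I : finType) (D : {set I})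
    (F : I -> set (set T)) : Prop :=
  forall (J : {set I}) (A : I -> set T), J \subset D ->
    (forall i, i \in J -> F i (A i)) ->
    P (\bigcap_(i in [set` J]) A i) = (\prod_(i in J) P (A i))%E.

Definition sigma_generated (d d' : measure_display) (T : measurableType d)
    (T' : measurableType d') (Z : T -> T') : set (set T) :=
  [set Z @^-1` B | B in measurable].

Section models.
Context (d : measure_display) (T : measurableType d) (R : realType).
Variables (P : probability T R) (m n : nat) (p : R).
Variables (M : 'M[R]_(m, n)).
(* X i j is the (i, j) entry of the data matrix, and W i j tells whether it is
   observed. *)
Variables (X : 'I_m -> 'I_n -> {RV P >-> R}).
Variables (W : 'I_m -> 'I_n -> {RV P >-> bool}).

Definition bounded_data_with_mean : Prop :=
  [/\ forall i j, `|M i j| <= 1,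
      forall i j, {ae P, forall w, `|X i j w| <= 1} &
      forall i j, ('E_P[X i j] = (M i j)%:E)%E].

(* The entries x_ij and the observation indicators at the positions in D form
   together one mutually independent family. *)
Definition independent_entries (D : {set 'I_m * 'I_n}) : Prop :=
  independent_classes P
    [set s : ('I_m * 'I_n) + ('I_m * 'I_n) |
       match s with inl q => q \in D | inr q => q \in D end]
    (fun s => match s with
              | inl q => sigma_generated (X q.1 q.2)
              | inr q => sigma_generated (W q.1 q.2)
              end).

Definition observed_with_prob : Prop :=
  forall i j, P [set w | W i j w = true] = p%:E.

Definition asymmetric_model : Prop :=
  [/\ bounded_data_with_mean, observed_with_prob &
      independent_entries [set: 'I_m * 'I_n]%SET].

Definition observed_data (w : T) : data_array R m n :=
  \matrix_(i < m, j < n) if W i j w then Some (X i j w) else None.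

Definition MSE (f : data_array R m n -> 'M[R]_(m, n)) : \bar R :=
  ('E_P[(fun w : T => (m * n)%:R^-1 *
     \sum_(i < m) \sum_(j < n) (f (observed_data w) i j - M i j) ^+ 2)%R])%E.

Definition data_is_mean : Prop := forall i j w, X i j w = M i j.

End models.

Section square_models.
Context (d : measure_display) (T : measurableType d) (R : realType).
Variables (P : probability T R) (n : nat) (p : R).
Variables (M : 'M[R]_n) (X : 'I_n -> 'I_n -> {RV P >-> R}).
Variables (W : 'I_n -> 'I_n -> {RV P >-> bool}).

Definition upper_triangle : {set 'I_n * 'I_n} :=
  [set q : 'I_n * 'I_n | (q.1 <= q.2)%N]%SET.

Definition symmetric_observation : Prop := forall i j w, W i j w = W j i w.

Definition symmetric_model : Prop :=
  [/\ M^T = M, forall i j w, X i j w = X j i w,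
      bounded_data_with_mean M X,
      observed_with_prob p W /\ symmetric_observation &
      independent_entries X W upper_triangle].

(* X - M has zero diagonal here; in particular X = M when n = 1, so that for
   p = 1 the observed data then determine M. *)
Definition skew_symmetric_model : Prop :=
  [/\ forall i j w, X i j w - M i j = - (X j i w - M j i),
      bounded_data_with_mean M X,
      observed_with_prob p W, symmetric_observation &
      independent_entries X W upper_triangle].

End square_models.

(* min {delta / (m sqrt (n p)), delta^2 / (m n), 1}, where the first term is
   +oo when p = 0. *)
Definition minimax_rate (R : realType) (m n : nat) (p delta : R) : \bar R :=
  Order.min (if p == 0 then +oo%E
             else (delta / (m%:R * Num.sqrt (n%:R * p)))%:E)
    (Order.min (delta ^+ 2 / (m * n)%:R) 1)%:E.

(* Main.v *)
(** Hide random signs in a block of r groups of k equal rows. The estimator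
learns a sign only by seeing one of its k copies; if 2 k p <= 1, or if k = 1 and
for p >= 1/2 the data are moreover erased by fair coins, then with probability
at least 1/2 it sees none of them, so that averaging over the signs it errs by
a^2 / 2 on average at every entry of size a in the block. The
nuclear norm is bounded by Cauchy-Schwarz through rank and Frobenius norm, and
maximal k and r balance the two bounds. In the square models the block sits in
the upper right corner and is repeated by (skew-)symmetry. *)

Require Import Defs.
From HB Require Import structures.
From mathcomp Require Import all_boot all_order all_algebra.
From mathcomp Require Import spectral complex.
From mathcomp Require Import all_classical all_reals all_analysis.
From mathcomp Require Import ring lra zify.

Set Implicit Arguments.
Unset Strict Implicit.
Unset Printing Implicit Defensive.

Import Order.TTheory GRing.Theory Num.Theory.
Import numFieldNormedType.Exports.

Local Open Scope classical_set_scope.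
Local Open Scope ring_scope.

(** * Finite families of independent biased coins *)

Section coin_space.
Context (R : realType) (I : finType).
Variable b : I -> R.
Hypothesis b01 : forall i, 0 <= b i <= 1.

(** An alias that carries the discrete sigma-algebra, so that every map out of it is measurable. *)
Definition coins (J : finType) : Type := {ffun J -> bool}.

HB.instance Definition _ (J : finType) := Finite.on (coins J).

HB.instance Definition _ (J : finType) :=
  isPointed.Build (coins J) [ffun=> false].

HB.instance Definition _ (J : finType) :=
  @isMeasurable.Build default_measure_display (coins J) discrete_measurable
    discrete_measurable0 discrete_measurableC discrete_measurableU.

Definition coin_weight (w : {ffun I -> bool}) : R :=
  \prod_i (if w i then b i else 1 - b i).

Lemma coin_weight_ge0 w : 0 <= coin_weight w.
Proof.
apply: prodr_ge0 => i _; have /andP[b0 b1] := b01 i.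
by case: ifP => // _; rewrite subr_ge0.
Qed.

(** Independence in computational form, by distributing a product over sums; the probabilities and
    expectations below are read off from it. *)
Lemma sum_coin_weight_prod (g : I -> bool -> R) :
  \sum_w coin_weight w * \prod_i g i (w i) =
  \prod_i (b i * g i true + (1 - b i) * g i false).
Proof.
transitivity (\sum_(w : {ffun I -> bool})
    \prod_i ((if w i then b i else 1 - b i) * g i (w i))).
  by apply: eq_bigr => w _; rewrite big_split.
rewrite -(bigA_distr_bigA (fun i v => (if v then b i else 1 - b i) * g i v)).
by apply: eq_bigr => i _; rewrite big_bool.
Qed.

Lemma sum_coin_weight : \sum_w coin_weight w = 1.
Proof.
have := sum_coin_weight_prod (fun _ _ => 1).
rewrite [RHS]big1 => [<-|i _]; last by rewrite !mulr1 subrKC.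
by apply: eq_bigr => w _; rewrite big1_eq mulr1.
Qed.

(** [msum] runs over an initial segment of the naturals, hence this numbering of the outcomes; the
    default of [nth] lies beyond that segment. *)
Let coin (k : nat) : coins I := nth [ffun=> false] (enum {ffun I -> bool}) k.

Definition coin_prob : set (coins I) -> \bar R :=
  msum (fun k => mscale (NngNum (coin_weight_ge0 (coin k))) \d_(coin k))
    #|{ffun I -> bool}|.

HB.instance Definition _ := Measure.on coin_prob.

Let sum_coin (F : coins I -> \bar R) :
  (\sum_(k < #|{ffun I -> bool}|) F (coin k) =
   \sum_(w : {ffun I -> bool}) F w)%E.
Proof.
have -> : #|{ffun I -> bool}| = size (enum {ffun I -> bool}) by rewrite cardE.
rewrite -(big_mkord xpredT (fun k => F (coin k))).
by rewrite -(big_nth _ xpredT F) big_enum.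
Qed.

Lemma coin_probE A :
  coin_prob A = (\sum_w coin_weight w * (w \in A)%:R)%:E.
Proof.
rewrite /coin_prob /msum (sum_coin
  (fun w => ((coin_weight w)%:E * \d_w A)%E)) -sumEFin.
by apply: eq_bigr => w _; rewrite diracE EFinM.
Qed.

Let coin_probT : coin_prob setT = 1%E.
Proof.
rewrite coin_probE -[in RHS]sum_coin_weight; congr EFin.
by apply: eq_bigr => w _; rewrite in_setT mulr1.
Qed.

HB.instance Definition _ :=
  @Measure_isProbability.Build _ _ R coin_prob coin_probT.

Let ge0_integral_coin (X : coins I -> R) : (forall w, 0 <= X w) ->
  (\int[coin_prob]_w (X w)%:E)%E = (\sum_w coin_weight w * X w)%:E.
Proof.
move=> X0; rewrite /coin_prob ge0_integral_measure_sum//; last by move=> w _; rewrite lee_fin.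
transitivity (\sum_(k < #|{ffun I -> bool}|) ((coin_weight (coin k))%:E * (X (coin k))%:E))%E.
  apply: eq_bigr => k _.
  rewrite ge0_integral_mscale//=; last by move=> w _; rewrite lee_fin.
  by rewrite integral_dirac// diracT mul1e.
apply: (etrans (sum_coin (fun w => (coin_weight w)%:E * (X w)%:E)%E)).
rewrite -sumEFin.
by apply: eq_bigr => w _; rewrite EFinM.
Qed.

Lemma expectation_coin (X : coins I -> R) :
  ('E_coin_prob[X] = (\sum_w coin_weight w * X w)%:E)%E.
Proof.
(* The formula for sums of measures is applied to nonnegative integrands, so the positive and
   negative parts are treated separately. *)
rewrite unlock integralE.
rewrite (eq_integral (fun w => (Num.max (X w) 0)%:E)); last first.
  by move=> w _; rewrite funeposE EFin_max.
rewrite [X in (_ - X)%E](eq_integral (fun w => (Num.max (- X w) 0)%:E)); last first.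
  by move=> w _; rewrite funenegE EFin_max.
rewrite !ge0_integral_coin; try by move=> w; rewrite le_max lexx orbT.
rewrite -EFinB -sumrB; congr EFin; apply: eq_bigr => w _.
rewrite -mulrBr; congr (_ * _).
have [x0|x0] := leP 0 (X w).
  by rewrite max_r ?subr0// oppr_le0.
by rewrite max_l ?sub0r ?opprK// oppr_ge0 ltW.
Qed.

Lemma coin_prob_cylinder (J : {set I}) (g : I -> pred bool) :
  coin_prob [set w : coins I | forall i, i \in J -> g i (w i)] =
  (\prod_(i in J) (b i * (g i true)%:R + (1 - b i) * (g i false)%:R))%:E.
Proof.
rewrite coin_probE; congr EFin; rewrite [RHS]big_mkcond/=.
(* The indicator of the cylinder is a product of one-coin factors, equal to 1 outside [J]. *)
pose G i v : R := if i \in J then (g i v)%:R else 1.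
transitivity (\sum_w coin_weight w * \prod_i G i (w i)).
  apply: eq_bigr => w _; congr (_ * _); rewrite /G -big_mkcond/=.
  have [wA|wA] := boolP (w \in _).
    by rewrite big1// => i iJ; move: wA; rewrite inE => /(_ i iJ) ->.
  have [|] := boolP [forall i, (i \in J) ==> g i (w i)]; last first.
    move=> /forallPn[j]; rewrite negb_imply => /andP[jJ gj].
    by rewrite (bigD1 j jJ)/= (negPf gj) mul0r.
  move/forallP => H; case/negP: wA; rewrite inE => i iJ.
  by have := H i; rewrite iJ.
rewrite sum_coin_weight_prod; apply: eq_bigr => i _; rewrite /G.
by case: ifP => // _; rewrite !mulr1 subrKC.
Qed.

Lemma coin_prob_cylinder1 (i : I) (g : pred bool) :
  coin_prob [set w : coins I | g (w i)] =
  (b i * (g true)%:R + (1 - b i) * (g false)%:R)%:E.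
Proof.
have := coin_prob_cylinder [set i]%SET (fun=> g).
rewrite big_set1 => <-; congr (coin_prob _).
apply/seteqP; split=> w /= gw; last by apply: gw; rewrite finset.inE.
by move=> j; rewrite finset.inE => /eqP ->.
Qed.

(** An intersection of events that each depend on their own coin is a cylinder, and the probability
    of a cylinder factors. *)
Lemma coin_independent (D : {set I}) (F : I -> set (set (coins I))) :
  (forall i A, i \in D -> F i A ->
     exists g : pred bool, A = [set w : coins I | g (w i)]) ->
  independent_classes coin_prob D F.
Proof.
move=> FD J A JD FA.
have {FA}/choice[g gA] i : exists g : pred bool,
    i \in J -> A i = [set w : coins I | g (w i)].
  have [iJ|_] := boolP (i \in J); last by exists xpredT.
  by have [g ->] := FD i (A i) (fintype.subsetP JD _ iJ) (FA _ iJ); exists g.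
transitivity (coin_prob [set w : coins I | forall i, i \in J -> g i (w i)]); last first.
  rewrite coin_prob_cylinder -prodEFin; apply: eq_bigr => i iJ.
  by rewrite gA//; apply/esym; exact: coin_prob_cylinder1.
congr (coin_prob _).
apply/seteqP; split=> w /= Aw i iJ; first by have := Aw i iJ; rewrite gA.
by rewrite gA//; exact: Aw.
Qed.

End coin_space.

Section finite_random_variable.
Context (R : realType) (I : finType) (b : I -> R).
Context (h : forall i, 0 <= b i <= 1).
Context (d : measure_display) (T' : measurableType d).

(** A named wrapper to which the measurability instance can be attached. *)
Definition coin_rv (g : coins I -> T') : coins I -> T' := g.

Let measurable_coin_rv g : measurable_fun setT (coin_rv g).
Proof. by []. Qed.

HB.instance Definition _ g :=
  isMeasurableFun.Build _ _ _ _ (coin_rv g) (measurable_coin_rv g).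

End finite_random_variable.

(** * Hidden signs and the average error of an estimator *)

Section hard_model.
Context (R : realType) (m n : nat) (p : R).
Hypothesis p01 : 0 <= p <= 1.
Notation pos := ('I_m * 'I_n)%type.
Context (par : finType).
(* [rep] identifies the positions that symmetry ties together, [s] is the signed
   support of the matrix, and the entry [q] hides the sign number
   [tau (rep q)]. *)
Variables (rep : pos -> pos) (s : pos -> R) (tau : pos -> par) (a : R).

(* The coin [inl q] decides the value of the data entry [q], the coin [inr q]
   whether it is observed. *)
Definition hard_bias (i : pos + pos) : R :=
  match i with inl _ => 2^-1 | inr _ => p end.

Lemma hard_bias01 i : 0 <= hard_bias i <= 1.
Proof. by case: i => q //=; lra. Qed.

Definition hard_prob : probability (coins (pos + pos)%type) R :=
  coin_prob hard_bias01.

Definition hard_mean (th : {ffun par -> bool}) : 'M[R]_(m, n) :=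
  \matrix_(i, j) (a * s (i, j) * (-1) ^+ th (tau (rep (i, j)))).

(* Deterministic data suffice for p < 1/2; otherwise fair coins erase the data
   entries, so that an observation is informative with probability p / 2. *)
Definition noise (v : bool) : R :=
  if p < 2^-1 then 1 else if v then 2 else 0.

Definition hard_data th (i : 'I_m) (j : 'I_n) : {RV hard_prob >-> R} :=
  coin_rv (fun w : coins (pos + pos)%type =>
    hard_mean th i j * noise (w (inl (rep (i, j))))).

Definition hard_obs (i : 'I_m) (j : 'I_n) : {RV hard_prob >-> bool} :=
  coin_rv (fun w : coins (pos + pos)%type => w (inr (rep (i, j)))).

Hypothesis a_bnd : 0 <= a <= 2^-1.
Hypothesis s_bnd : forall q, `|s q| <= 1.

(** The bound 1/2 instead of 1 leaves room for the noise, which may double an entry. *)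
Lemma hard_mean_le th i j : `|hard_mean th i j| <= 2^-1.
Proof.
rewrite mxE !normrM normrX normrN1 expr1n mulr1.
have /andP[a0 a1] := a_bnd; rewrite (ger0_norm a0).
by have := s_bnd (i, j); have := normr_ge0 (s (i, j)); nra.
Qed.

Lemma hard_bounded th : bounded_data_with_mean (hard_mean th) (hard_data th).
Proof.
split=> i j.
- by apply: le_trans (hard_mean_le th i j) _; lra.
- apply: aeW => w /=; rewrite /coin_rv normrM.
  have : `|noise (w (inl (rep (i, j))))| <= 2.
    by rewrite /noise; case: ifP => _; [|case: ifP => _]; rewrite ?normr1 ?normr0 ?ger0_norm; lra.
  have := hard_mean_le th i j; have := normr_ge0 (hard_mean th i j).
  by have := normr_ge0 (noise (w (inl (rep (i, j))))); nra.
rewrite expectation_coin /hard_data /coin_rv/=; congr EFin.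
pose G (c : pos + pos) v : R := if c == inl (rep (i, j)) then noise v else 1.
under eq_bigr => w _ do rewrite mulrCA.
rewrite -mulr_sumr -[RHS]mulr1; congr (_ * _).
transitivity (\sum_w coin_weight hard_bias w * \prod_c G c (w c)).
  apply: eq_bigr => w _; rewrite (bigD1 (inl (rep (i, j))))//= {1}/G eqxx.
  by rewrite big1 ?mulr1// /G => c /negPf ->.
rewrite sum_coin_weight_prod (bigD1 (inl (rep (i, j))))//= /G eqxx.
rewrite big1 => [|c /negPf ->]; last by rewrite !mulr1 subrKC.
(* The noise has mean 1: it is constantly 1, or else 2 and 0 with probability 1/2 each. *)
by rewrite /noise; case: ifP => _; lra.
Qed.

Lemma hard_observed : observed_with_prob p hard_obs.
Proof.
move=> i j; rewrite /hard_obs /coin_rv.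
have := @coin_prob_cylinder1 R _ hard_bias hard_bias01 (inr (rep (i, j))) id.
by rewrite /= mulr1 mulr0 addr0.
Qed.

(** Where [rep] fixes [q], the data entry and the indicator at [q] depend only on the coins [inl q]
    and [inr q]. *)
Lemma hard_independent th (D : {set pos}) : (forall q, q \in D -> rep q = q) ->
  independent_entries (hard_data th) hard_obs D.
Proof.
move=> repD; apply: coin_independent => -[] q A; rewrite finset.inE => qD.
  case=> B _ <-; exists (fun v => `[<B (hard_mean th q.1 q.2 * noise v)>]).
  apply/seteqP; split=> w /=; rewrite /coin_rv -surjective_pairing (repD _ qD).
    by move=> Bw; apply/asboolP.
  by move/asboolP.
case=> B _ <-; exists (fun v => `[<B v>]).
apply/seteqP; split=> w /=; rewrite /coin_rv -surjective_pairing (repD _ qD).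
  by move=> Bw; apply/asboolP.
by move/asboolP.
Qed.

Lemma hard_data_is_mean th : p < 2^-1 -> data_is_mean (hard_mean th) (hard_data th).
Proof. by move=> p2 i j w; rewrite /= /coin_rv /noise p2 mulr1. Qed.

(** An erased entry shows 0 for either sign, so it reveals nothing even when observed. *)
Definition informative (w : coins (pos + pos)%type) (q : pos) : bool :=
  w (inr q) && (noise (w (inl q)) != 0).

Definition silent (t : par) (w : coins (pos + pos)%type) : bool :=
  [forall q, (tau q == t) ==> ~~ informative w q].

Definition informative_rate : R := if p < 2^-1 then p else p / 2.

Lemma informative_rateE q :
  \sum_w coin_weight hard_bias w * (informative w q)%:R = informative_rate.
Proof.
pose G (c : pos + pos) v : R := if c == inl q then (noise v != 0)%:R else
  if c == inr q then v%:R else 1.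
transitivity (\sum_w coin_weight hard_bias w * \prod_c G c (w c)).
  apply: eq_bigr => w _; congr (_ * _).
  rewrite (bigD1 (inl q))//= (bigD1 (inr q))//= big1 => [|c].
    by rewrite /G /= !eqxx mulr1 -natrM mulnb andbC.
  by case/andP => /negPf cl /negPf cr; rewrite /G cl cr.
rewrite sum_coin_weight_prod (bigD1 (inl q))//= (bigD1 (inr q))//= big1 => [|c].
  rewrite /G /= !eqxx /noise /informative_rate.
  by case: ifP => _; rewrite ?oner_eq0 ?eqxx ?pnatr_eq0/=; lra.
by case/andP => /negPf cl /negPf cr; rewrite /G cl cr !mulr1 subrKC.
Qed.

Variable k : nat.
Hypothesis tau_fiber : forall t, (#|[set q | tau q == t]%SET| <= k)%N.
Hypothesis k_rate : k%:R * informative_rate <= 2^-1.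

(** Union bound over the at most [k] positions of the group [t], each informative with probability
    [informative_rate]. *)
Lemma silent_prob_ge t :
  2^-1 <= \sum_w coin_weight hard_bias w * (silent t w)%:R.
Proof.
have weight0 := coin_weight_ge0 hard_bias01.
suff : \sum_w coin_weight hard_bias w * (~~ silent t w)%:R <= 2^-1.
  move=> H; have := sum_coin_weight hard_bias.
  rewrite (_ : \sum_w _ = \sum_w coin_weight hard_bias w * (silent t w)%:R +
     \sum_w coin_weight hard_bias w * (~~ silent t w)%:R); first lra.
  rewrite -big_split/=; apply: eq_bigr => w _.
  by case: silent => /=; rewrite mulr1 mulr0 ?addr0 ?add0r.
apply: le_trans k_rate.
apply: (@le_trans _ _ (\sum_(q | tau q == t) informative_rate)).
  rewrite -(eq_bigr _ (fun q _ => informative_rateE q)) exchange_big/=.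
  apply: ler_sum => w _; rewrite -mulr_sumr ler_wpM2l//.
  have [//|/= ] := boolP (silent t w); first by rewrite sumr_ge0.
  move=> /forallPn[q]; rewrite negb_imply negbK => /andP[tq iq].
  by rewrite (bigD1 q)//= iq lerDl sumr_ge0.
rewrite sumr_const -[leLHS]mulr_natl ler_wpM2r//.
  by have /andP[p0 _] := p01; rewrite /informative_rate; case: ifP => _; lra.
by rewrite ler_nat; apply: leq_trans (tau_fiber t); rewrite cardsE.
Qed.

Definition flip (t : par) (th : {ffun par -> bool}) : {ffun par -> bool} :=
  [ffun u => th u (+) (u == t)].

Lemma flipK t : involutive (flip t).
Proof. by move=> th; apply/ffunP => u; rewrite !ffunE addbK. Qed.

Lemma observed_data_flip t th w : silent t w ->
  observed_data (hard_data (flip t th)) hard_obs w =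
  observed_data (hard_data th) hard_obs w.
Proof.
move=> /forallP sil; apply/matrixP => i j; rewrite !mxE.
rewrite /= /coin_rv.
have := sil (rep (i, j)); rewrite /informative.
case: (w (inr _)) => //=; rewrite negbK.
have [tq /= /eqP ->|tq _] := eqVneq (tau _) t; first by rewrite !mulr0.
by rewrite !mxE !ffunE (negPf tq) addbF.
Qed.

Variable f : data_array R m n -> 'M[R]_(m, n).

Let err th w (q : pos) : R :=
  (f (observed_data (hard_data th) hard_obs w) q.1 q.2 - hard_mean th q.1 q.2) ^+ 2.

Lemma hard_MSE th : MSE (hard_mean th) (hard_data th) hard_obs f =
  ((m * n)%:R^-1 * \sum_q \sum_w coin_weight hard_bias w * err th w q)%:E.
Proof.
rewrite /MSE expectation_coin; congr EFin.
rewrite exchange_big/= mulr_sumr; apply: eq_bigr => w _.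
by rewrite -mulr_sumr mulrCA pair_bigA.
Qed.

(** Two-point argument: if the group of [q] is silent, the data under [th] and under [flip t th]
    agree, so one estimate faces two opposite values of size [|a * s q|], at a total squared error
    of at least [2 (a * s q)^2]. This event has probability at least 1/2, and flipping permutes the
    sign assignments. *)
Let sum_err_ge q : #|{ffun par -> bool}|%:R * ((a * s q) ^+ 2 / 2) <=
  \sum_th \sum_w coin_weight hard_bias w * err th w q.
Proof.
have weight0 := coin_weight_ge0 hard_bias01.
set t := tau (rep q); set G := fun th => \sum_w coin_weight hard_bias w * err th w q.
have pair_ge th : (a * s q) ^+ 2 <= G th + G (flip t th).
  rewrite -big_split/=.
  apply: (@le_trans _ _ (\sum_w coin_weight hard_bias w * (silent t w)%:R * (2 * (a * s q) ^+ 2))).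
    rewrite -mulr_suml; have := silent_prob_ge t; have := sqr_ge0 (a * s q); nra.
  apply: ler_sum => w _; rewrite -mulrDr -mulrA ler_wpM2l//.
  have [sil|_] := boolP (silent t w); last first.
    by rewrite mul0r addr_ge0// sqr_ge0.
  rewrite mul1r /err (observed_data_flip th sil) !mxE /t !ffunE -surjective_pairing eqxx.
  set y := f _ _ _; rewrite addbT signrN.
  have : ((-1) ^+ th (tau (rep q)) : R) ^+ 2 = 1 by rewrite sqrr_sign.
  by move: ((-1) ^+ _) => e ?; nra.
have flip_sum : \sum_th G (flip t th) = \sum_th G th.
  by rewrite [RHS](reindex_inj (inv_inj (flipK t))).
have : \sum_(th : {ffun par -> bool}) (a * s q) ^+ 2 <= \sum_th G th + \sum_th G th.
  by rewrite -[X in _ + X]flip_sum -big_split/=; apply: ler_sum => th _; exact: pair_ge.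
by rewrite sumr_const -mulr_natl; lra.
Qed.

(** The bound holds on average over all sign assignments, so not all of them can fall below it. *)
Lemma hard_signs_exist : exists th, ((a ^+ 2 * (\sum_q s q ^+ 2) / (2 * (m * n)%:R))%:E
  <= MSE (hard_mean th) (hard_data th) hard_obs f)%E.
Proof.
apply/not_existsP => H.
pose V := a ^+ 2 * (\sum_q s q ^+ 2) / (2 * (m * n)%:R).
pose E th := (m * n)%:R^-1 * \sum_q \sum_w coin_weight hard_bias w * err th w q.
have {}H th : E th < V by have := H th; rewrite hard_MSE lee_fin => /negP; rewrite -ltNge.
have : \sum_th E th < \sum_(th : {ffun par -> bool}) V.
  apply: ltr_sum => //; apply/hasP; exists [ffun=> false] => //; exact: mem_index_enum.
apply/negP; rewrite -leNgt.
rewrite (_ : \sum_(th : {ffun par -> bool}) V =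
    (m * n)%:R^-1 * \sum_q #|{ffun par -> bool}|%:R * ((a * s q) ^+ 2 / 2)).
  by rewrite /E -[leRHS]mulr_sumr exchange_big/= ler_wpM2l ?invr_ge0// ler_sum.
rewrite sumr_const -mulr_sumr /V invfM -[LHS]mulr_natl.
rewrite (_ : \sum_q (a * s q) ^+ 2 / 2 = a ^+ 2 * (\sum_q s q ^+ 2) / 2); last first.
  by rewrite mulr_sumr mulr_suml; apply: eq_bigr => q _; rewrite exprMn.
set y := (m * n)%:R^-1; set S := \sum_q _.
by field.
Qed.

End hard_model.

(** * Nuclear norm through rank and Frobenius norm *)

(** Cauchy-Schwarz against the constant 1, from expanding the sum of the squares of
    [N * x j - S]. *)
Lemma sqr_sum_le (R : realFieldType) (I : finType) (J : pred I) (x : I -> R) :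
  (\sum_(j | J j) x j) ^+ 2 <= #|J|%:R * \sum_(j | J j) x j ^+ 2.
Proof.
set S := \sum_(j | J j) x j; set Q := \sum_(j | J j) _; set N : R := #|J|%:R.
have [N0|N_gt0] := leqP #|J| 0.
  have J0 : J =1 pred0 by apply/card0_eq/eqP; rewrite -leqn0.
  by rewrite /S /Q !big_pred0// expr0n mulr0.
have {N_gt0} Ngt0 : 0 < N by rewrite ltr0n.
have : 0 <= \sum_(j | J j) (N * x j - S) ^+ 2 by apply: sumr_ge0 => j _; exact: sqr_ge0.
rewrite (eq_bigr (fun j => N ^+ 2 * x j ^+ 2 - (2 * N * S) * x j + S ^+ 2)); last first.
  by move=> j _; ring.
rewrite big_split/= sumrB sumr_const -[S ^+ 2 *+ _]mulr_natl -!mulr_sumr -/S -/Q -/N.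
have -> : N ^+ 2 * Q - 2 * N * S * S + N * S ^+ 2 = N * (N * Q - S ^+ 2) by ring.
by rewrite pmulr_rge0// subr_ge0.
Qed.

(** The nonzero diagonal entries cut out an invertible diagonal submatrix. *)
Lemma card_diag_le_rank (F : fieldType) (n : nat) (d : 'rV[F]_n) :
  (#|[pred j | d 0%R j != 0%R]| <= \rank (diag_mx d))%N.
Proof.
pose J := [pred j | d 0%R j != 0]; pose g (u : 'I_#|J|) : 'I_n := enum_val u.
have E : mxsub g g (diag_mx d) = diag_mx (\row_u d 0%R (g u)).
  apply/matrixP => u v; rewrite !mxE.
  by rewrite (inj_eq (@enum_val_inj _ _)).
have : diag_mx (\row_u d 0%R (g u)) \in unitmx.
  rewrite unitmxE det_diag unitfE; apply/prodf_neq0 => u _; rewrite mxE.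
  by have := enum_valP u.
move=> /mxrank_unit <-; rewrite -E.
have -> : mxsub g g (diag_mx d) = rowsub g 1%:M *m diag_mx d *m colsub g 1%:M.
  by rewrite mul_rowsub_mx mul1mx mulmx_colsub mulmx1 mxsubcr.
by apply: leq_trans (mxrankM_maxl _ _) (mxrankM_maxr _ _).
Qed.

(** At most [\rank M] singular values are nonzero, and their squares sum to the trace of [M^T *m M],
    the squared Frobenius norm; Cauchy-Schwarz over the nonzero ones concludes. *)
Lemma nuclear_norm_le (R : realType) (m n r : nat) (M : 'M[R]_(m, n)) :
  (\rank M <= r)%N ->
  nuclear_norm M <= Num.sqrt (r%:R * \sum_i \sum_j M i j ^+ 2).
Proof.
move=> Mr.
set S := map_mx (real_complex R) (M^T *m M).
set d := spectral_diag S; set P := spectralmx S.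
have conj_rc (p q : nat) (A : 'M[R]_(p, q)) :
    map_mx Num.conj (map_mx (real_complex R) A) = map_mx (real_complex R) A.
  by apply/matrixP => i j; rewrite !mxE; exact: conjc_real.
have S_tr : S^T = S.
  apply/matrixP => i j; rewrite !mxE; congr ((real_complex R) _).
  by apply: eq_bigr => l _; rewrite !mxE mulrC.
have Sn : S \is normalmx by apply/normalmxP; rewrite S_tr conj_rc.
have P_unitary : P \is unitarymx := spectral_unitarymx S.
(* Writing the diagonal matrix as [B B^*] with [B = P M^T] yields both the sign of the eigenvalues
   and the rank bound. *)
have dE : diag_mx d = (P *m map_mx (real_complex R) M^T) *m
    map_mx Num.conj (P *m map_mx (real_complex R) M^T)^T.
  have := orthomx_spectralP Sn; rewrite -/d -/P => SE.
  have -> : diag_mx d = P *m S *m invmx P.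
    by rewrite SE !mulmxA mulmxV ?unitarymx_unit// mul1mx mulmxK ?unitarymx_unit.
  have MT : map_mx Num.conj (map_mx (real_complex R) M^T)^T = map_mx (real_complex R) M.
    by apply/matrixP => i j; rewrite !mxE; exact: conjc_real.
  by rewrite invmx_unitary// trmx_mul map_mxM/= MT /S map_mxM !mulmxA.
have d_ge0 j : 0 <= d 0%R j.
  have : 0 <= (diag_mx d) j j.
    rewrite dE mxE; apply: sumr_ge0 => k _.
    by rewrite !mxE -normCK exprn_ge0.
  by rewrite mxE eqxx mulr1n.
have d_rank : (#|[pred j | d 0%R j != 0%R]| <= r)%N.
  apply: leq_trans (card_diag_le_rank d) (leq_trans _ Mr).
  rewrite dE -mulmxA; apply: leq_trans (mxrankM_maxr _ _) _.
  apply: leq_trans (mxrankM_maxl _ _) _.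
  by rewrite mxrank_map mxrank_tr.
have d_trace : \sum_j complex.Re (d 0%R j) = \sum_i \sum_j M i j ^+ 2.
  transitivity (complex.Re (\tr S)).
    rewrite (orthomx_spectralP Sn) -/d -/P mxtrace_mulC mulmxA mulmxV ?unitarymx_unit//.
    by rewrite mul1mx mxtrace_diag raddf_sum.
  rewrite /S trace_map_mx/= /mxtrace exchange_big/=; apply: eq_bigr => j _.
  by rewrite mxE; apply: eq_bigr => i _; rewrite mxE expr2.
rewrite -(@ler_pXn2r _ 2)// ?nnegrE ?sqrtr_ge0 ?sumr_ge0//; last first.
  by move=> j _; exact: sqrtr_ge0.
have Re_ge0 j : 0 <= complex.Re (d 0%R j).
  by have := d_ge0 j; rewrite lecE => /andP[].
have sqr_sv j : singular_value M j ^+ 2 = complex.Re (d 0%R j).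
  by rewrite sqr_sqrtr.
rewrite sqr_sqrtr; last by rewrite mulr_ge0// sumr_ge0// => i _; rewrite sumr_ge0// => j _; rewrite sqr_ge0.
rewrite /nuclear_norm (bigID [pred j | d 0%R j != 0%R])/= [X in _ + X]big1 ?addr0; last first.
  by move=> j; rewrite negbK /singular_value => /eqP; rewrite -/S -/d => ->; rewrite sqrtr0.
apply: le_trans (sqr_sum_le _ _) _.
apply: ler_pM; rewrite ?ler0n ?ler_nat//; first by apply: sumr_ge0 => j _; exact: sqr_ge0.
rewrite -d_trace [leRHS](bigID [pred j | d 0%R j != 0%R])/= (eq_bigr _ (fun j _ => sqr_sv j)).
by rewrite lerDl sumr_ge0.
Qed.

(** * Balancing the parameters against the rate *)

(** Reaching any one term of the minimum suffices; [p != 0] rules out the infinite value of the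
    first. *)
Lemma minimax_rate_le (R : realType) (m n : nat) (p delta c V : R) : 0 < c ->
  [\/ c <= V, c * (delta ^+ 2 / (m * n)%:R) <= V |
      p != 0 /\ c * (delta / (m%:R * Num.sqrt (n%:R * p))) <= V] ->
  (c%:E * minimax_rate m n p delta <= V%:E)%E.
Proof.
move=> c0 H; rewrite /minimax_rate.
set x := (if _ then _ else _); set y := delta ^+ 2 / _ in H *.
have : (Order.min x (Order.min y 1)%:E <= x)%E /\
       (Order.min x (Order.min y 1)%:E <= y%:E)%E /\
       (Order.min x (Order.min y 1)%:E <= 1%:E)%E.
  by rewrite !ge_min lexx /= !lee_fin !ge_min !lexx !orbT.
have c0' : (0 <= c%:E)%E by rewrite lee_fin ltW.
move=> [mx [my m1]]; case: H => [H|H|[p0 H]].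
- by apply: le_trans (lee_wpmul2l c0' m1) _; rewrite mule1 lee_fin.
- by apply: le_trans (lee_wpmul2l c0' my) _; rewrite -EFinM lee_fin.
- by apply: le_trans (lee_wpmul2l c0' mx) _; rewrite /x (negPf p0) -EFinM lee_fin.
Qed.

(* [k] rows share a sign pattern, so that a sign stays hidden with probability
   at least 1/2 as long as [2 k p <= 1]; [r] is the number of such groups, and
   [a] the size of the entries. Both [k] and [r] are chosen maximal. *)
Lemma minimax_parameters (R : realType) (m n h : nat) (p delta : R) :
  (0 < h)%N -> (m <= 3 * h)%N -> (h <= m)%N -> (0 < n)%N -> 0 <= p <= 1 -> 0 <= delta ->
  exists k r a, [/\ (0 < k)%N /\ (r * k <= h)%N, k = 1%N \/ 2 * k%:R * p <= 1,
    0 <= a <= 2^-1, 2 * a * r%:R * Num.sqrt (k * n)%:R <= delta &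
    ((48^-1)%:E * minimax_rate m n p delta <= (a ^+ 2 * (r * k)%:R / (2 * m%:R))%:E)%E].
Proof.
move=> h0 m3h hm n0 /andP[p0 p1] d0.
pose Pk k := [&& (0 < k)%N, (k <= h)%N & (k == 1%N) || (2 * k%:R * p <= 1)].
have exk : exists k, Pk k by exists 1%N; rewrite /Pk h0 eqxx.
have Pkh k : Pk k -> (k <= h)%N by case/and3P.
case: (ex_maxnP exk Pkh) => k /and3P[k0 kh k_or] kmax.
set T : R := Num.sqrt (k * n)%:R.
have T0 : 0 < T by rewrite sqrtr_gt0 ltr0n muln_gt0 k0.
pose Pr r := [&& (0 < r)%N, (r * k <= h)%N & (r == 1%N) || (r%:R * T <= delta)].
have exr : exists r, Pr r by exists 1%N; rewrite /Pr mul1n kh eqxx.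
have Prh r : Pr r -> (r <= h)%N.
  by case/and3P => _ rk _; apply: leq_trans rk; rewrite leq_pmulr.
case: (ex_maxnP exr Prh) => r /and3P[r0 rk r_or] rmax.
have r0R : 0 < r%:R :> R by rewrite ltr0n.
have rT0 : 0 < r%:R * T by rewrite mulr_gt0.
have u0 : 0 < 2 * (r%:R * T) by rewrite mulr_gt0.
(* The second value makes the nuclear norm bound [2 a r T] equal to [delta]; the first is the cap
   imposed by the noise. *)
pose a := Num.min 2^-1 (delta / (2 * (r%:R * T))).
have m0 : 0 < m%:R :> R by rewrite ltr0n (leq_trans h0).
have n0R : 0 < n%:R :> R by rewrite ltr0n.
have k0R : 0 < k%:R :> R by rewrite ltr0n.
have T2 : T ^+ 2 = k%:R * n%:R by rewrite sqr_sqrtr ?natrM// mulr_ge0// ltW.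
exists k, r, a; split=> //.
- by case/orP: k_or => [/eqP ->|]; [left|right].
- by rewrite /a le_min ge_min lexx andbT; apply/andP; split; [lra | exact: divr_ge0 (ltW u0)].
- have : a <= delta / (2 * (r%:R * T)) by rewrite /a ge_min lexx orbT.
  by rewrite ler_pdivlMr// -/T; congr (_ <= _); ring.
apply: minimax_rate_le; first lra.
have [a_eq|a_lt] := leP 2^-1 (delta / (2 * (r%:R * T))); last first.
  (* Below the cap [delta < r T], which forces [r = 1]; then [k] cancels and the second term appears
     with factor 1/8. *)
  have aE : a = delta / (2 * (r%:R * T)) by rewrite /a min_r// ltW.
  have r1 : r = 1%N.
    case/orP: r_or => [/eqP//|rd]; exfalso; move: a_lt.
    by rewrite ltr_pdivrMr//; lra.
  apply: Or32; rewrite aE r1 !mul1n mul1r expr_div_n exprMn T2 natrM.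
  rewrite (_ : _ / _ * _ / _ = 8^-1 * (delta ^+ 2 / (m%:R * n%:R))).
    apply: ler_wpM2r; last lra.
    by rewrite divr_ge0// ?mulr_ge0 ?sqr_ge0// ltW.
  by field; rewrite !gt_eqF.
have aE : a = 2^-1 by rewrite /a min_l.
have V_E : a ^+ 2 * (r * k)%:R / (2 * m%:R) = r%:R * k%:R / (8 * m%:R).
  by rewrite aE natrM; field; lra.
rewrite V_E.
(* The constant arises here: [m <= 3 h <= 6 r k], so [r k / (8 m) >= 1/48]. *)
have large_rk : (h <= 2 * (r * k))%N -> 48^-1 <= r%:R * k%:R / (8 * m%:R) :> R.
  move=> hrk; have : (m <= 6 * (r * k))%N.
    by apply: leq_trans m3h _; rewrite -[6%N]/(3 * 2)%N -mulnA leq_mul2l.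
  by rewrite -(ler_nat R) !natrM ler_pdivlMr; lra.
(* If [h] is what stops [r] or [k] from growing, the block fills at least half of the height and the
   term 1 is reached. Otherwise [delta] limits [r] and [p] limits [k]. *)
have [rk_gt|rk_le] := ltnP h (r.+1 * k).
  apply/Or31/large_rk/(leq_trans (ltnW rk_gt)).
  by rewrite mulSn mul2n -addnn leq_add2r leq_pmull.
have rT_gt : delta < r.+1%:R * T.
  rewrite ltNge; apply/negP => rT_le.
  by have := rmax r.+1; rewrite /Pr rk_le rT_le orbT ltnn => /(_ isT).
have [k_ge|k_lt] := leqP h k.
  by apply/Or31/large_rk/(leq_trans k_ge); rewrite mulnA leq_pmull ?muln_gt0.
have kp_gt : 1 < 2 * k.+1%:R * p.
  rewrite ltNge; apply/negP => kp_le.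
  by have := kmax k.+1; rewrite /Pk k_lt kp_le orbT ltnn => /(_ isT).
have k1R : 1 <= k%:R :> R by rewrite ler1n.
have r1R : 1 <= r%:R :> R by rewrite ler1n.
have kp4 : 1 <= 4 * (k%:R * p) by move: kp_gt; rewrite -natr1; nra.
have pn0 : 0 < p by rewrite lt_neqAle p0 andbT; apply/eqP => pE; move: kp4; rewrite -pE; lra.
apply: Or33; split; first by rewrite gt_eqF.
set s := Num.sqrt (n%:R * p).
have s0 : 0 < s by rewrite sqrtr_gt0 mulr_gt0.
have s2 : s ^+ 2 = n%:R * p by rewrite sqr_sqrtr// ltW// mulr_gt0.
(* From [4 k p >= 1] follows [k n <= 4 k^2 n p]. *)
have Ts : T <= 2 * (k%:R * s).
  rewrite -(@ler_pXn2r _ 2)// ?nnegrE ?mulr_ge0 ?sqrtr_ge0//.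
  rewrite !exprMn T2 s2.
  rewrite (_ : 2 ^+ 2 * _ = (k%:R * n%:R) * (4 * (k%:R * p))); last by ring.
  apply: ler_peMr => //; exact: ltW (mulr_gt0 k0R n0R).
(* By [r + 1 <= 2 r]. Hence [r k / (8 m) >= delta / (32 m s)], better than the factor 1/48 asked of
   the first term. *)
have delta_le : delta <= r%:R * (4 * (k%:R * s)).
  apply: le_trans (ltW rT_gt) _; rewrite -natr1.
  have ks0 : 0 < k%:R * s by rewrite mulr_gt0.
  by nra.
rewrite ler_pdivlMr ?mulr_gt0//.
rewrite (_ : _ * (8 * m%:R) = delta / (6 * s)); last by field; rewrite !gt_eqF.
by rewrite ler_pdivrMr ?mulr_gt0//; nra.
Qed.

(** * Groups of equal rows and the common hard instance *)

(** [M] factors through dimension [r]: [A] marks the group of each row, [B] holds one row per group,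
    zero for an empty group. *)
Lemma rank_grouped_rows (F : fieldType) (m n r : nat) (M : 'M[F]_(m, n))
    (g : 'I_m -> nat) :
  (forall i j, (r <= g i)%N -> M i j = 0) ->
  (forall i i' j, g i = g i' -> M i j = M i' j) -> (\rank M <= r)%N.
Proof.
move=> M0 Mg.
pose A : 'M[F]_(m, r) := \matrix_(i, u) (g i == u)%:R.
pose B : 'M[F]_(r, n) :=
  \matrix_(u, j) if [pick i | g i == u] is Some i then M i j else 0.
suff -> : M = A *m B.
  by apply: leq_trans (mxrankM_maxl A B) _; exact: rank_leq_col.
apply/matrixP => i j; rewrite mxE.
have [gr|gr] := leqP r (g i).
  rewrite M0// big1// => u _; rewrite !mxE.
  by rewrite gtn_eqF ?mul0r// (leq_trans (ltn_ord u)).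
rewrite (bigD1 (Ordinal gr))//= big1 ?addr0 => [|u].
  rewrite !mxE eqxx mul1r; case: pickP => [i' /eqP /= gi'|/(_ i)]; last by rewrite eqxx.
  exact: Mg.
rewrite !mxE -val_eqE /= eq_sym => /negPf ->; exact: mul0r.
Qed.

(** Signs are numbered by positions: [k] consecutive rows share one sign in each column, and
    [q.1 %/ k <= q.1] keeps the row index in range. *)
Definition row_group (m n k : nat) (q : 'I_m * 'I_n) : 'I_m * 'I_n :=
  (Ordinal (leq_ltn_trans (leq_div q.1 k) (ltn_ord q.1)), q.2).

(** Inside a group, the row modulo [k] determines the position. *)
Lemma card_row_group (m n k : nat) (t : 'I_m * 'I_n) : (0 < k)%N ->
  (#|[set q | row_group k q == t]%SET| <= k)%N.
Proof.
move=> k0; pose g (q : 'I_m * 'I_n) : 'I_k := Ordinal (ltn_pmod q.1 k0).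
rewrite -[leqRHS]card_ord -(@card_in_imset _ _ g) ?max_card//.
move=> [i j] [i' j']; rewrite !finset.inE => /eqP <- /eqP[] Ei <- [] Em.
congr (_, _); apply: val_inj => /=.
by rewrite (divn_eq i k) (divn_eq i' k) Ei Em.
Qed.

Lemma sum_prefix (R : pzRingType) (m l : nat) : (l <= m)%N ->
  \sum_(i < m) ((i < l)%N)%:R = l%:R :> R.
Proof.
move=> lm; rewrite -natr_sum; congr _%:R.
rewrite (eq_bigr (fun i : 'I_m => if (i < l)%N then 1%N else 0%N)); last first.
  by move=> i _; case: ltnP.
by rewrite -big_mkcond/= -(big_ord_widen m (fun=> 1%N) lm) sum1_card card_ord.
Qed.

Section hard_instance.
Context (R : realType) (m n : nat) (p : R).
Hypothesis p01 : 0 <= p <= 1.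
Variables (rep : 'I_m * 'I_n -> 'I_m * 'I_n) (s : 'I_m * 'I_n -> R).
Variables (k r : nat) (a delta : R).

Local Notation mean := (hard_mean rep s (@row_group m n k) a).
Local Notation data := (hard_data p01 rep s (@row_group m n k) a).
Local Notation obs := (hard_obs p01 rep).

Lemma hard_frobenius th : \sum_i \sum_j mean th i j ^+ 2 = a ^+ 2 * \sum_q s q ^+ 2.
Proof.
rewrite mulr_sumr pair_bigA; apply: eq_bigr => -[i j] _.
by rewrite mxE !exprMn sqrr_sign mulr1.
Qed.

Lemma hard_nuclear_norm_le th (rk l : nat) : 0 <= a -> (\rank (mean th) <= rk)%N ->
  \sum_q s q ^+ 2 <= l%:R ->
  nuclear_norm (mean th) <= a * Num.sqrt (rk * l)%:R.
Proof.
move=> a0 Mrk sl; apply: le_trans (nuclear_norm_le Mrk) _.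
rewrite hard_frobenius -[X in _ <= X * _](ger0_norm a0) -sqrtr_sqr -sqrtrM ?sqr_ge0//.
by rewrite ler_wsqrtr// mulrCA ler_wpM2l ?sqr_ge0// natrM ler_wpM2l.
Qed.

(** The part common to all three models, which differ only in [rep] and [s]. *)
Lemma hard_instance (f : data_array R m n -> 'M[R]_(m, n)) :
  (0 < m)%N -> (0 < n)%N -> (0 < k)%N -> k = 1%N \/ 2 * k%:R * p <= 1 ->
  0 <= a <= 2^-1 -> (forall q, `|s q| <= 1) ->
  (r * k * n)%:R <= \sum_q s q ^+ 2 ->
  ((48^-1)%:E * minimax_rate m n p delta <= (a ^+ 2 * (r * k)%:R / (2 * m%:R))%:E)%E ->
  exists th, [/\ bounded_data_with_mean (mean th) (data th),
    observed_with_prob p obs,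
    forall D : {set 'I_m * 'I_n}, (forall q, q \in D -> rep q = q) ->
      independent_entries (data th) obs D,
    ((48^-1)%:E * minimax_rate m n p delta <= MSE (mean th) (data th) obs f)%E &
    p < 2^-1 -> data_is_mean (mean th) (data th)].
Proof.
move=> m0 n0 k0 kp a_bnd s_bnd s_ge rate_le.
have /andP[p0 p1] := p01.
have k_rate : k%:R * informative_rate p <= 2^-1.
  (* For [k = 1] the erasure, active once [p >= 1/2], keeps the rate at most 1/2. *)
  rewrite /informative_rate; case: kp => [->|kp]; case: ltP => p2; [lra|lra|nra|].
  have : 0 <= k%:R * p by rewrite mulr_ge0.
  by move: (k%:R) kp => K; nra.
have [th MSE_ge] := hard_signs_exist p01 rep s a (fun t => card_row_group t k0) k_rate f.
exists th; split.
- exact: hard_bounded.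
- exact: hard_observed.
- by move=> D; exact: hard_independent.
- apply: le_trans rate_le (le_trans _ MSE_ge); rewrite lee_fin.
  have m0R : 0 < m%:R :> R by rewrite ltr0n.
  have n0R : 0 < n%:R :> R by rewrite ltr0n.
  rewrite ler_pdivlMr; last by rewrite mulr_gt0// ltr0n muln_gt0 m0.
  rewrite (_ : _ / _ * _ = a ^+ 2 * (r * k * n)%:R); last first.
    by rewrite !natrM; field; rewrite gt_eqF.
  by rewrite ler_wpM2l ?sqr_ge0.
- exact: hard_data_is_mean.
Qed.

End hard_instance.

(** * The asymmetric model *)

Lemma asymmetric_lower_bound (R : realType) (m n : nat) (p : R)
    (f : data_array R m n -> 'M[R]_(m, n)) (delta : R) :
  (1 <= m)%N -> (m <= n)%N -> 0 <= p <= 1 -> 0 <= delta ->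
  exists (M : 'M[R]_(m, n)) (d : measure_display) (T : measurableType d)
    (P : probability T R) (X : 'I_m -> 'I_n -> {RV P >-> R})
    (W : 'I_m -> 'I_n -> {RV P >-> bool}),
    [/\ asymmetric_model p M X W, nuclear_norm M <= delta,
        ((48^-1)%:E * minimax_rate m n p delta <= MSE M X W f)%E &
        p < 2^-1 -> data_is_mean M X].
Proof.
move=> m0 mn p01 d0; have n0 := leq_trans m0 mn.
have m3 : (m <= 3 * m)%N by lia.
have [k [r [a [[k0 rk] kp a_bnd nuc rate_le]]]] :=
  minimax_parameters m0 m3 (leqnn m) n0 p01 d0.
have /andP[a0 _] := a_bnd.
(* The block is the first [r k] rows at full width. *)
pose s (q : 'I_m * 'I_n) : R := (q.1 < r * k)%N%:R.
have s_bnd q : `|s q| <= 1 by rewrite /s; case: ltnP; rewrite ?normr1 ?normr0.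
have s_sum : \sum_q s q ^+ 2 = (r * k * n)%:R.
  rewrite -(pair_bigA _ (fun i j => s (i, j) ^+ 2))/=.
  rewrite (eq_bigr (fun i : 'I_m => (i < r * k)%N%:R * n%:R)).
    by rewrite -mulr_suml sum_prefix// -natrM.
  move=> i _; rewrite /s/= sumr_const card_ord -[LHS]mulr_natr.
  by case: ltnP; rewrite ?expr1n ?expr0n.
have s_ge : (r * k * n)%:R <= \sum_q s q ^+ 2 by rewrite s_sum.
have s_le : \sum_q s q ^+ 2 <= (r * k * n)%:R by rewrite s_sum.
have [th [bounded observed indep mse mean_eq]] :=
  hard_instance p01 id f m0 n0 k0 kp a_bnd s_bnd s_ge rate_le.
do 6 eexists; split; [split; [exact: bounded|exact: observed|] | |exact: mse|exact: mean_eq].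
  exact: indep.
apply: le_trans nuc.
have rank_le : (\rank (hard_mean id s (@row_group m n k) a th) <= r)%N.
  apply: (@rank_grouped_rows _ _ _ _ _ (fun i => (i %/ k)%N)) => [i j|i i' j ii'].
    by rewrite leq_divRL// mxE /s/= ltnNge => ->; rewrite mulr0 mul0r.
  rewrite !mxE /s/= -!ltn_divLR// ii'; congr (_ * (-1) ^+ nat_of_bool (th _)).
  by congr (_, _); apply: val_inj.
apply: le_trans (hard_nuclear_norm_le a0 rank_le s_le) _.
have -> : Num.sqrt (r * (r * k * n))%:R = r%:R * Num.sqrt (k * n)%:R :> R.
  have -> : (r * (r * k * n))%:R = r%:R ^+ 2 * (k * n)%:R :> R by rewrite !natrM; ring.
  by rewrite sqrtrM ?sqr_ge0// sqrtr_sqr ger0_norm.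
(* The factor 2 in [nuc] accounts for the square models, where the bounds on the rank and on the
   squared Frobenius norm both double. *)
have : 0 <= a * (r%:R * Num.sqrt (k * n)%:R) by rewrite !mulr_ge0 ?sqrtr_ge0.
lra.
Qed.

(** * The symmetric and skew-symmetric models *)

Definition min_max (n : nat) (q : 'I_n * 'I_n) : 'I_n * 'I_n :=
  if (q.1 <= q.2)%N then q else (q.2, q.1).

Lemma min_maxC (n : nat) (i j : 'I_n) : min_max (i, j) = min_max (j, i).
Proof.
rewrite /min_max/=; case: ltngtP => //= ij.
by congr (_, _); apply: val_inj.
Qed.

(** In the skew case [M] and [X] are both taken skew-symmetric, so that [X - M] is too. A block off
    the diagonal exists because [n >= 2]. *)
Lemma square_lower_bound (R : realType) (skew : bool) (n : nat) (p : R)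
    (f : data_array R n n -> 'M[R]_n) (delta : R) :
  (2 <= n)%N -> 0 <= p <= 1 -> 0 <= delta ->
  exists (M : 'M[R]_n) (d : measure_display) (T : measurableType d)
    (P : probability T R) (X : 'I_n -> 'I_n -> {RV P >-> R})
    (W : 'I_n -> 'I_n -> {RV P >-> bool}),
    [/\ if skew then skew_symmetric_model p M X W else symmetric_model p M X W,
        nuclear_norm M <= delta,
        ((48^-1)%:E * minimax_rate n n p delta <= MSE M X W f)%E &
        p < 2^-1 -> data_is_mean M X].
Proof.
move=> n2 p01 d0; pose h := n./2.
have n0 : (0 < n)%N by lia.
have h0 : (0 < h)%N by rewrite /h; lia.
have n3h : (n <= 3 * h)%N by rewrite /h; lia.
have hn : (h <= n)%N by rewrite /h; lia.
have [k [r [a [[k0 rk] kp a_bnd nuc rate_le]]]] :=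
  minimax_parameters h0 n3h hn n0 p01 d0.
have /andP[a0 _] := a_bnd.
pose e : R := (-1) ^+ skew.
(* As [r k <= h], the corner lies strictly above the diagonal and misses its mirror image. *)
pose corner (i j : 'I_n) : bool := (i < r * k)%N && (h <= j)%N.
pose s (q : 'I_n * 'I_n) : R := (corner q.1 q.2)%:R + e * (corner q.2 q.1)%:R.
have cornerN i j : corner i j -> corner j i = false.
  by case/andP => ir hj; rewrite /corner ltnNge (leq_trans rk hj).
have e2 : e ^+ 2 = 1 by rewrite sqrr_sign.
have s2 q : s q ^+ 2 = (corner q.1 q.2)%:R + (corner q.2 q.1)%:R.
  rewrite /s; case: (boolP (corner q.1 q.2)) => [/cornerN ->|_].
    by rewrite mulr0 !addr0 expr1n.
  by rewrite !add0r exprMn e2 mul1r; case: (corner _ _); rewrite ?expr1n ?expr0n.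
have s_bnd q : `|s q| <= 1.
  rewrite -(@ler_pXn2r _ 2)// ?nnegrE// expr1n real_normK ?num_real// s2.
  by case: (boolP (corner q.1 q.2)) => [/cornerN ->|_]; rewrite ?addr0// add0r lern1 leq_b1.
have sum_corner : \sum_i \sum_j (corner i j)%:R = (r * k * (n - h))%:R :> R.
  transitivity (\sum_(i < n) (i < r * k)%N%:R * \sum_(j < n) (h <= j)%N%:R : R).
    apply: eq_bigr => i _; rewrite mulr_sumr; apply: eq_bigr => j _.
    by rewrite /corner -natrM mulnb.
  rewrite -mulr_suml sum_prefix ?(leq_trans rk)// [RHS]natrM; congr (_ * _).
  have : \sum_(j < n) ((j < h)%N%:R + (h <= j)%N%:R) = n%:R :> R.
    transitivity (\sum_(j < n) (1 : R)); last by rewrite sumr_const card_ord.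
    by apply: eq_bigr => j _; case: leqP => _; rewrite ?addr0 ?add0r.
  by rewrite big_split/= sum_prefix// natrB//; lra.
have s_sum : \sum_q s q ^+ 2 = (2 * (r * k * (n - h)))%:R.
  rewrite (eq_bigr _ (fun q _ => s2 q)).
  rewrite -(pair_bigA _ (fun i j => (corner i j)%:R + (corner j i)%:R))/=.
  rewrite (eq_bigr _ (fun i _ => big_split _ _ _ _ _))/= big_split/=.
  by rewrite [X in _ + X]exchange_big/= sum_corner -natrD addnn -mul2n.
(* [2 (n - h) >= n]: the mirror image makes up for the columns cut off. *)
have s_ge : (r * k * n)%:R <= \sum_q s q ^+ 2.
  by rewrite s_sum ler_nat mulnCA leq_mul2l; apply/orP; right; rewrite /h; lia.
have s_le : \sum_q s q ^+ 2 <= (2 * (r * k * n))%:R.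
  by rewrite s_sum ler_nat !leq_mul2l leq_subr !orbT.
have [th [bounded observed indep mse mean_eq]] :=
  hard_instance p01 (@min_max n) f n0 n0 k0 kp a_bnd s_bnd s_ge rate_le.
have sC i j : s (j, i) = e * s (i, j).
  by rewrite /s/= mulrDr mulrA -expr2 e2 mul1r addrC.
have meanC i j : hard_mean (@min_max n) s (@row_group n n k) a th j i =
    e * hard_mean (@min_max n) s (@row_group n n k) a th i j.
  by rewrite !mxE sC min_maxC; ring.
do 6 eexists; split; [ | |exact: mse|exact: mean_eq].
  case: ifP => skewE.
    split; [|exact: bounded|exact: observed| |].
    - move=> i j w; rewrite /= /coin_rv min_maxC meanC /e skewE; ring.
    - by move=> i j w; rewrite /= /coin_rv min_maxC.
    - by apply: indep => q; rewrite finset.inE /min_max => ->.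
  split; [| |exact: bounded|split; [exact: observed|]|].
  - by apply/matrixP => i j; rewrite mxE meanC /e skewE mul1r.
  - by move=> i j w; rewrite /= /coin_rv min_maxC meanC /e skewE mul1r.
  - by move=> i j w; rewrite /= /coin_rv min_maxC.
  - by apply: indep => q; rewrite finset.inE /min_max => ->.
apply: le_trans nuc.
(* [U] is the corner alone; the mean is [U + e *: U^T], so the rank at most doubles. *)
pose U := \matrix_(i, j) (a * (corner i j)%:R * (-1) ^+ th (@row_group n n k (i, j))) : 'M[R]_n.
have rank_U : (\rank U <= r)%N.
  apply: (@rank_grouped_rows _ _ _ _ _ (fun i => (i %/ k)%N)) => [i j|i i' j ii'].
    by rewrite leq_divRL// mxE /corner ltnNge => ->; rewrite mulr0 mul0r.
  rewrite !mxE /corner -!ltn_divLR// ii'; congr (_ * (-1) ^+ nat_of_bool (th _)).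
  by congr (_, _); apply: val_inj.
have rank_le : (\rank (hard_mean (@min_max n) s (@row_group n n k) a th) <= 2 * r)%N.
  rewrite (_ : hard_mean _ _ _ _ _ = U + e *: U^T).
    rewrite mul2n -addnn; apply: leq_trans (mxrank_add _ _) (leq_add rank_U _).
    by apply: leq_trans rank_U; rewrite -(mxrank_tr U) -mul_scalar_mx mxrankM_maxr.
  apply/matrixP => i j; rewrite !mxE /s/= /min_max/=.
  have [cij|cij] := boolP (corner i j).
    rewrite (cornerN _ _ cij) ifT ?mulr0 ?mul0r ?mulr0 ?addr0//.
    by case/andP: cij => ir hj; rewrite (leq_trans _ hj)// (leq_trans (ltnW ir)).
  have [cji|cji] := boolP (corner j i).
    rewrite ifF; first by rewrite /=; ring.
    by case/andP: cji => jr hi; rewrite leqNgt (leq_trans jr)// (leq_trans rk).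
  by rewrite !(mulr0, mul0r, addr0).
apply: le_trans (hard_nuclear_norm_le a0 rank_le s_le) _.
have -> : Num.sqrt (2 * r * (2 * (r * k * n)))%:R =
    2 * r%:R * Num.sqrt (k * n)%:R :> R.
  have -> : (2 * r * (2 * (r * k * n)))%:R = (2 * r%:R) ^+ 2 * (k * n)%:R :> R.
    by rewrite !natrM; ring.
  by rewrite sqrtrM ?sqr_ge0// sqrtr_sqr ger0_norm// mulr_ge0.
by rewrite le_eqVlt; apply/orP; left; apply/eqP; ring.
Qed.

(** * The case [n = 1] and the three bounds together *)

Lemma asymmetric_model1 (d : measure_display) (T : measurableType d) (R : realType)
    (P : probability T R) (p : R) (M : 'M[R]_1) (X : 'I_1 -> 'I_1 -> {RV P >-> R})
    (W : 'I_1 -> 'I_1 -> {RV P >-> bool}) :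
  asymmetric_model p M X W -> symmetric_model p M X W.
Proof.
have upperT : upper_triangle 1 = [set: 'I_1 * 'I_1]%SET.
  by apply/setP => -[i j]; rewrite !finset.inE !ord1.
case=> bounded observed indep; split=> //.
- by apply/matrixP => i j; rewrite mxE !ord1.
- by move=> i j w; rewrite !ord1.
- by split=> // i j w; rewrite !ord1.
- by rewrite upperT.
Qed.

Lemma symmetric_skew_symmetric (d : measure_display) (T : measurableType d)
    (R : realType) (P : probability T R) (n : nat) (p : R) (M : 'M[R]_n)
    (X : 'I_n -> 'I_n -> {RV P >-> R}) (W : 'I_n -> 'I_n -> {RV P >-> bool}) :
  data_is_mean M X -> symmetric_model p M X W -> skew_symmetric_model p M X W.
Proof.
move=> XM [_ _ bounded [observed Wsym] indep]; split=> // i j w.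
by rewrite !XM !subrr oppr0.
Qed.

Theorem theorem1p2 (R : realType) :
  exists c : R, 0 < c /\
  (forall (m n : nat) (p : R) (f : data_array R m n -> 'M[R]_(m, n))
      (delta : R),
    (1 <= m)%N -> (m <= n)%N -> 0 <= p <= 1 -> is_estimator f ->
    0 <= delta <= m%:R * Num.sqrt n%:R ->
    exists (M : 'M[R]_(m, n)) (d : measure_display) (T : measurableType d)
      (P : probability T R) (X : 'I_m -> 'I_n -> {RV P >-> R})
      (W : 'I_m -> 'I_n -> {RV P >-> bool}),
      [/\ asymmetric_model p M X W,
          nuclear_norm M <= delta,
          (c%:E * minimax_rate m n p delta <= MSE M X W f)%E &
          p < 2^-1 -> data_is_mean M X]) /\
  (forall (n : nat) (p : R) (f : data_array R n n -> 'M[R]_n) (delta : R),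
    (1 <= n)%N -> 0 <= p <= 1 -> is_estimator f ->
    0 <= delta <= n%:R * Num.sqrt n%:R ->
    exists (M : 'M[R]_n) (d : measure_display) (T : measurableType d)
      (P : probability T R) (X : 'I_n -> 'I_n -> {RV P >-> R})
      (W : 'I_n -> 'I_n -> {RV P >-> bool}),
      [/\ symmetric_model p M X W,
          nuclear_norm M <= delta,
          (c%:E * minimax_rate n n p delta <= MSE M X W f)%E &
          p < 2^-1 -> data_is_mean M X]) /\
  (forall (n : nat) (p : R) (f : data_array R n n -> 'M[R]_n) (delta : R),
    (1 <= n)%N -> 0 <= p <= 1 -> (2 <= n)%N \/ p < 2^-1 -> is_estimator f ->
    0 <= delta <= n%:R * Num.sqrt n%:R ->
    exists (M : 'M[R]_n) (d : measure_display) (T : measurableType d)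
      (P : probability T R) (X : 'I_n -> 'I_n -> {RV P >-> R})
      (W : 'I_n -> 'I_n -> {RV P >-> bool}),
      [/\ skew_symmetric_model p M X W,
          nuclear_norm M <= delta,
          (c%:E * minimax_rate n n p delta <= MSE M X W f)%E &
          p < 2^-1 -> data_is_mean M X]).
Proof.
exists 48^-1; split; first lra.
split=> [m n p f delta m0 mn p01 _ /andP[d0 _]|].
  exact: asymmetric_lower_bound.
split=> n p f delta n0 p01; first move=> _ /andP[d0 _].
  have [n2|] := leqP 2 n; first exact: (square_lower_bound false).
  case: n n0 f => [//|[|//]] _ f _.
  have [M [d [T [P [X [W [model nuc mse mean_eq]]]]]]] :=
    asymmetric_lower_bound f (leqnn 1) (leqnn 1) p01 d0.
  exists M, d, T, P, X, W; split=> //; exact: asymmetric_model1.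
move=> n_or _ /andP[d0 _].
have [n2|] := leqP 2 n; first exact: (square_lower_bound true).
(* For [n = 1] the hypothesis leaves [p < 1/2]; there [X = M], and the difference 0 is
   skew-symmetric. *)
case: n n0 f n_or => [//|[|//]] _ f [//|p2] _.
have [M [d [T [P [X [W [model nuc mse mean_eq]]]]]]] :=
  asymmetric_lower_bound f (leqnn 1) (leqnn 1) p01 d0.
exists M, d, T, P, X, W; split=> //.
by apply: symmetric_skew_symmetric (mean_eq p2) _; exact: asymmetric_model1.
Qed.
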